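(* Let $\mathbf{A}$ be a fixed finite linearly ordered MTL-algebra, let $\mathcal{P}$ be a predicate language and let $T$ be a consistent theory (set of $\mathcal{P}$-sentences). Then the class $Mod_{\mathbf{A}}(T)$ of $\mathbf{A}$-models of $T$ is closed under homomorphisms and under $\mathbf{A}$-direct products if and only if $T$ is axiomatized by a set of positive-primitive sentences, i.e. there is a set $\Sigma$ of pp-sentences of $\mathcal{P}$ with $Mod_{\mathbf{A}}(T)=Mod_{\mathbf{A}}(\Sigma)$.
   Context: MTL-algebras are the algebraic semantics of Esteva–Godo's monoidal t-norm based logic MTL: bounded integral commutative residuated lattices satisfying prelinearity; $\&$ is interpreted by the monoidal operation $*$, $\wedge$ by the lattice meet (min, since $\mathbf{A}$ is linear), $\vee$ by max, $\to$ by the residuum. A predicate language $\mathcal{P}$ consists of predicate symbols and function symbols (possibly individual constants) with arities, together with an equality symbol $\approx$. An $\mathbf{A}$-structure $\mathbf{M}$ for $\mathcal{P}$ consists of a nonempty domain $M$, for each $n$-ary predicate symbol $P$ a map $P_{\mathbf{M}}:M^n\to A$, and for each $n$-ary function symbol $F$ a function $F_{\mathbf{M}}:M^n\to M$; equality is interpreted as crisp identity (value $1$ if equal, bottom otherwise). Truth values $\|\varphi\|_{\mathbf{M},v}$ under an assignment $v$ are defined recursively in the usual Tarskian way: atomic formulas get the value of the predicate at the values of the terms, connectives are computed in $\mathbf{A}$, $\|(\forall x)\varphi\|$ is the infimum (here minimum) and $\|(\exists x)\varphi\|$ the supremum (here maximum) of $\|\varphi\|_{\mathbf{M},v[x\mapsto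 a]}$ over $a\in M$. All structures are $\mathbf{A}$-structures. $\mathbf{M}$ is a model of a set of sentences $\Sigma$ if every $\varphi\in\Sigma$ has value $1$ in $\mathbf{M}$; $Mod_{\mathbf{A}}(\Sigma)$ is the class of such models; a theory $T$ is axiomatized by $\Sigma$ if $Mod_{\mathbf{A}}(T)=Mod_{\mathbf{A}}(\Sigma)$. A theory is consistent if it does not derive the truth constant $\overline{0}$ in the predicate logic MTL$\forall_=$. $T$ is closed under an operation if applying it to $\mathbf{A}$-models of $T$ always yields an $\mathbf{A}$-model of $T$. A homomorphism from $\mathbf{M}$ to $\mathbf{N}$ is a map $g:M\to N$ with $g(F_{\mathbf{M}}(d_1,\dots,d_n))=F_{\mathbf{N}}(g(d_1),\dots,g(d_n))$ for every function symbol $F$, and such that for every predicate symbol $P$, $\|P(d_1,\dots,d_n)\|_{\mathbf{M}}=1$ implies $\|P(g(d_1),\dots,g(d_n))\|_{\mathbf{N}}=1$. The $\mathbf{A}$-direct product $\prod_{i\in I}\mathbf{M}_i$ of a family of structures indexed by a nonempty set $I$ has as domain the classical Cartesian product, function symbols interpreted componentwise, and $P(\bar d_1,\dots,\bar d_n)=\min\{P_{\mathbf{M}_i}(\bar d_1(i),\dots,\bar d_n(i)) : i\in I\}$. A pp-formula (positive-primitive, or $\wedge\&$-primitive formula) is a formula of the form $(\exists\bar x)\psi$ where $\psi$ is quantifier-free and built from atomic formulas using only the connectives $\wedge$ and $\&$; a pp-sentence is a pp-formula without free variables.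
   Formalization: The truth constant 0̄ is counted among the atomic formulas in pp-sentences; without it the claim fails for consistent T with no A-models (e.g. two-valued A, T = {p ↔ ¬p}), and for T having an A-model the claim is unchanged. *)

(* Defs.v *)
(* MathComp, with the classical axioms of mathcomp.classical.boolp. *)
From HB Require Import structures.
From mathcomp Require Import all_boot all_order.
From mathcomp Require Import boolp.

Set Implicit Arguments.
Unset Strict Implicit.
Unset Printing Implicit Defensive.

Import Order.TTheory.
Local Open Scope order_scope.

(** * MTL-algebras *)

Record MTL_algebra (d : Order.disp_t) (A : tbLatticeType d) := MTLAlgebra {
  mtl_mul : A -> A -> A;
  mtl_res : A -> A -> A;
  mtl_mulA : associative mtl_mul;
  mtl_mulC : commutative mtl_mul;
  mtl_mul1 : left_id \top mtl_mul;
  mtl_resP : forall x y z : A, (mtl_mul x y <= z) = (x <= mtl_res y z);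
  mtl_prelinear : forall x y : A, mtl_res x y `|` mtl_res y x = \top }.

(* Infima and suprema of families with values in a finite chain. The index
   type may be infinite, but the set of values is finite, so that both bounds
   are attained as soon as the family is nonempty. *)
Definition inf_fam (d : Order.disp_t) (A : finTBOrderType d) (I : Type)
    (f : I -> A) : A :=
  \meet_(a : A | `[< exists i, f i = a >]) a.

Definition sup_fam (d : Order.disp_t) (A : finTBOrderType d) (I : Type)
    (f : I -> A) : A :=
  \join_(a : A | `[< exists i, f i = a >]) a.

(** * Syntax *)

Record language := Language {
  pred_sym : Type;
  pred_ar : pred_sym -> nat;
  fun_sym : Type;
  fun_ar : fun_sym -> nat }.

Inductive term (P : language) : Type :=
| Var of nat
| App (F : fun_sym P) of ('I_(fun_ar F) -> term P).

(* fAmp is the strong conjunction &, fWedge the lattice conjunction. *)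
Inductive formula (P : language) : Type :=
| fPred (R : pred_sym P) of ('I_(pred_ar R) -> term P)
| fEq of term P & term P
| fBot
| fAmp of formula P & formula P
| fWedge of formula P & formula P
| fImp of formula P & formula P
| fAll of nat & formula P
| fEx of nat & formula P.

Arguments Var {P} _.
Arguments App {P} F _.
Arguments fPred {P} R _.
Arguments fBot {P}.

(* The remaining connectives of MTL, by their usual definitions. *)
Definition fTop {P : language} : formula P := fImp fBot fBot.
Definition fNeg (P : language) (phi : formula P) := fImp phi fBot.
Definition fIff (P : language) (phi psi : formula P) :=
  fAmp (fImp phi psi) (fImp psi phi).
Definition fOr (P : language) (phi psi : formula P) :=
  fWedge (fImp (fImp phi psi) psi) (fImp (fImp psi phi) phi).

Fixpoint occurs (P : language) (x : nat) (t : term P) : Prop :=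
  match t with
  | Var y => x = y
  | App F ts => exists i, occurs x (ts i)
  end.

Fixpoint free (P : language) (x : nat) (phi : formula P) : Prop :=
  match phi with
  | fPred R ts => exists i, occurs x (ts i)
  | fEq s t => occurs x s \/ occurs x t
  | fBot => False
  | fAmp phi1 phi2 | fWedge phi1 phi2 | fImp phi1 phi2 =>
      free x phi1 \/ free x phi2
  | fAll y phi1 | fEx y phi1 => x <> y /\ free x phi1
  end.

Definition sentence (P : language) (phi : formula P) : Prop :=
  forall x, ~ free x phi.

Fixpoint tsubst (P : language) (x : nat) (t s : term P) : term P :=
  match s with
  | Var y => if y == x then t else Var y
  | App F ts => App F (fun i => tsubst x t (ts i))
  end.

(* Replacement of the free occurrences of x by t, without renaming: only
   meaningful when t is substitutable for x. *)
Fixpoint subst (P : language) (x : nat) (t : term P) (phi : formula P) :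
    formula P :=
  match phi with
  | fPred R ts => fPred R (fun i => tsubst x t (ts i))
  | fEq s1 s2 => fEq (tsubst x t s1) (tsubst x t s2)
  | fBot => fBot
  | fAmp phi1 phi2 => fAmp (subst x t phi1) (subst x t phi2)
  | fWedge phi1 phi2 => fWedge (subst x t phi1) (subst x t phi2)
  | fImp phi1 phi2 => fImp (subst x t phi1) (subst x t phi2)
  | fAll y phi1 => fAll y (if y == x then phi1 else subst x t phi1)
  | fEx y phi1 => fEx y (if y == x then phi1 else subst x t phi1)
  end.

Fixpoint substitutable (P : language) (x : nat) (t : term P)
    (phi : formula P) : Prop :=
  match phi with
  | fPred _ _ | fEq _ _ | fBot => True
  | fAmp phi1 phi2 | fWedge phi1 phi2 | fImp phi1 phi2 =>
      substitutable x t phi1 /\ substitutable x t phi2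
  | fAll y phi1 | fEx y phi1 =>
      x <> y /\ free x phi1 -> ~ occurs y t /\ substitutable x t phi1
  end.

(** * The predicate logic MTL with crisp equality *)

(* Esteva and Godo's axioms of MTL, Hajek's quantifier axioms, and the axioms
   of a crisp congruence. *)
Inductive MTL_axiom (P : language) : formula P -> Prop :=
| ax_trans phi psi chi :
    MTL_axiom (fImp (fImp phi psi) (fImp (fImp psi chi) (fImp phi chi)))
| ax_amp_l phi psi : MTL_axiom (fImp (fAmp phi psi) phi)
| ax_amp_comm phi psi : MTL_axiom (fImp (fAmp phi psi) (fAmp psi phi))
| ax_wedge_l phi psi : MTL_axiom (fImp (fWedge phi psi) phi)
| ax_wedge_comm phi psi : MTL_axiom (fImp (fWedge phi psi) (fWedge psi phi))
| ax_div phi psi :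
    MTL_axiom (fImp (fAmp phi (fImp phi psi)) (fWedge phi psi))
| ax_uncurry phi psi chi :
    MTL_axiom (fImp (fImp phi (fImp psi chi)) (fImp (fAmp phi psi) chi))
| ax_curry phi psi chi :
    MTL_axiom (fImp (fImp (fAmp phi psi) chi) (fImp phi (fImp psi chi)))
| ax_prelin phi psi chi :
    MTL_axiom (fImp (fImp (fImp phi psi) chi)
                    (fImp (fImp (fImp psi phi) chi) chi))
| ax_bot phi : MTL_axiom (fImp fBot phi)
| ax_all_inst x t phi : substitutable x t phi ->
    MTL_axiom (fImp (fAll x phi) (subst x t phi))
| ax_ex_inst x t phi : substitutable x t phi ->
    MTL_axiom (fImp (subst x t phi) (fEx x phi))
| ax_all_imp x nu phi : ~ free x nu ->
    MTL_axiom (fImp (fAll x (fImp nu phi)) (fImp nu (fAll x phi)))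
| ax_ex_imp x nu phi : ~ free x nu ->
    MTL_axiom (fImp (fAll x (fImp phi nu)) (fImp (fEx x phi) nu))
| ax_all_or x nu phi : ~ free x nu ->
    MTL_axiom (fImp (fAll x (fOr phi nu)) (fOr (fAll x phi) nu))
| ax_eq_refl s : MTL_axiom (fEq s s)
| ax_eq_sym s t : MTL_axiom (fImp (fEq s t) (fEq t s))
| ax_eq_trans s t u : MTL_axiom (fImp (fAmp (fEq s t) (fEq t u)) (fEq s u))
| ax_eq_fun (F : fun_sym P) (ss ts : 'I_(fun_ar F) -> term P) :
    MTL_axiom (fImp (\big[@fAmp P/fTop]_(i < fun_ar F) fEq (ss i) (ts i))
                    (fEq (App F ss) (App F ts)))
| ax_eq_pred (R : pred_sym P) (ss ts : 'I_(pred_ar R) -> term P) :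
    MTL_axiom (fImp (\big[@fAmp P/fTop]_(i < pred_ar R) fEq (ss i) (ts i))
                    (fIff (fPred R ss) (fPred R ts)))
| ax_eq_crisp s t : MTL_axiom (fOr (fEq s t) (fNeg (fEq s t))).

Inductive derives (P : language) (T : formula P -> Prop) :
    formula P -> Prop :=
| drv_hyp phi : T phi -> derives T phi
| drv_ax phi : MTL_axiom phi -> derives T phi
| drv_mp phi psi : derives T phi -> derives T (fImp phi psi) -> derives T psi
| drv_gen x phi : derives T phi -> derives T (fAll x phi).

Definition theory (P : language) (T : formula P -> Prop) : Prop :=
  forall phi, T phi -> sentence phi.

Definition consistent (P : language) (T : formula P -> Prop) : Prop :=
  ~ derives T fBot.

(** * Structures and truth values *)

Record structure (P : language) (A : Type) := Structure {
  dom :> Type;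
  dom_inhabited : inhabited dom;
  pred_interp : forall R : pred_sym P, ('I_(pred_ar R) -> dom) -> A;
  fun_interp : forall F : fun_sym P, ('I_(fun_ar F) -> dom) -> dom }.

Fixpoint teval (P : language) (A : Type) (M : structure P A) (v : nat -> M)
    (t : term P) : M :=
  match t with
  | Var x => v x
  | App F ts => fun_interp (fun i => teval v (ts i))
  end.

Definition upd (D : Type) (v : nat -> D) (x : nat) (a : D) : nat -> D :=
  fun y => if y == x then a else v y.

Fixpoint eval (d : Order.disp_t) (A : finTBOrderType d) (L : MTL_algebra A)
    (P : language) (M : structure P A) (v : nat -> M) (phi : formula P) : A :=
  match phi with
  | fPred R ts => pred_interp (fun i => teval v (ts i))
  | fEq s t => if `[< teval v s = teval v t >] then \top else \bot
  | fBot => \bot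
  | fAmp phi1 phi2 => mtl_mul L (eval L v phi1) (eval L v phi2)
  | fWedge phi1 phi2 => eval L v phi1 `&` eval L v phi2
  | fImp phi1 phi2 => mtl_res L (eval L v phi1) (eval L v phi2)
  | fAll x phi1 => inf_fam (fun a : M => eval L (upd v x a) phi1)
  | fEx x phi1 => sup_fam (fun a : M => eval L (upd v x a) phi1)
  end.

(* For sentences the value does not depend on the assignment v. *)
Definition model (d : Order.disp_t) (A : finTBOrderType d) (L : MTL_algebra A)
    (P : language) (T : formula P -> Prop) (M : structure P A) : Prop :=
  forall phi, T phi -> forall v : nat -> M, eval L v phi = \top.

Definition axiomatized_by (d : Order.disp_t) (A : finTBOrderType d)
    (L : MTL_algebra A) (P : language) (T Sigma : formula P -> Prop) : Prop :=
  forall M : structure P A, model L T M <-> model L Sigma M.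

(** * Closure operations *)

Definition homomorphism (d : Order.disp_t) (A : finTBOrderType d)
    (P : language) (M N : structure P A) (g : M -> N) : Prop :=
  (forall (F : fun_sym P) (ds : 'I_(fun_ar F) -> M),
      g (fun_interp ds) = fun_interp (fun i => g (ds i))) /\
  (forall (R : pred_sym P) (ds : 'I_(pred_ar R) -> M),
      pred_interp ds = \top -> pred_interp (fun i => g (ds i)) = \top).

Lemma prod_inhabited (P : language) (A : Type) (I : Type)
  (Ms : I -> structure P A) : inhabited (forall i, Ms i).
Proof.
have h i : exists x : Ms i, True by have [x] := dom_inhabited (Ms i); exists x.
exact: inhabits (fun i => projT1 (cid (h i))).
Qed.

Definition direct_product (d : Order.disp_t) (A : finTBOrderType d)
    (P : language) (I : Type) (Ms : I -> structure P A) : structure P A :=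
  {| dom := forall i, Ms i;
     dom_inhabited := prod_inhabited Ms;
     pred_interp := fun R ds =>
       inf_fam (fun i : I => pred_interp (fun k => ds k i));
     fun_interp := fun F ds i => fun_interp (fun k => ds k i) |}.

Definition closed_under_homomorphisms (d : Order.disp_t)
    (A : finTBOrderType d) (L : MTL_algebra A) (P : language)
    (T : formula P -> Prop) : Prop :=
  forall (M N : structure P A) (g : M -> N),
    homomorphism g -> model L T M -> model L T N.

Definition closed_under_products (d : Order.disp_t)
    (A : finTBOrderType d) (L : MTL_algebra A) (P : language)
    (T : formula P -> Prop) : Prop :=
  forall (I : Type) (Ms : I -> structure P A), inhabited I ->
    (forall i, model L T (Ms i)) -> model L T (direct_product Ms).

(** * Positive-primitive formulas *)

(* The truth constant fBot counts as an atomic formula. It is only of use for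
   axiomatizing theories without A-models (a theory can be consistent in MTL
   and have none: take A two-valued and T = {p <-> ~ p}); see
   [pp_true_falsum_free] below. *)
Fixpoint pp_matrix (P : language) (phi : formula P) : Prop :=
  match phi with
  | fPred _ _ | fEq _ _ | fBot => True
  | fAmp phi1 phi2 | fWedge phi1 phi2 => pp_matrix phi1 /\ pp_matrix phi2
  | _ => False
  end.

Definition pp_formula (P : language) (phi : formula P) : Prop :=
  exists (xs : seq nat) (psi : formula P),
    pp_matrix psi /\ phi = foldr (@fEx P) psi xs.

Definition pp_sentence (P : language) (phi : formula P) : Prop :=
  pp_formula phi /\ sentence phi.

Fixpoint falsum_free (P : language) (phi : formula P) : Prop :=
  match phi with
  | fPred _ _ | fEq _ _ => True
  | fBot => False
  | fAmp phi1 phi2 | fWedge phi1 phi2 | fImp phi1 phi2 =>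
      falsum_free phi1 /\ falsum_free phi2
  | fAll _ phi1 | fEx _ phi1 => falsum_free phi1
  end.

(** * Sanity checks *)

Section Checks.
Context (d : Order.disp_t) (A : finTBOrderType d) (L : MTL_algebra A).

Lemma inf_famP (I : Type) (f : I -> A) (a : A) :
  a <= inf_fam f <-> forall i, a <= f i.
Proof.
split=> [/meetsP h i|h]; first by apply: h; apply/asboolP; exists i.
by apply/meetsP => b /asboolP [i <-].
Qed.

Lemma sup_famP (I : Type) (f : I -> A) (a : A) :
  sup_fam f <= a <-> forall i, f i <= a.
Proof.
split=> [/joinsP h i|h]; first by apply: h; apply/asboolP; exists i.
by apply/joinsP => b /asboolP [i <-].
Qed.

Lemma mtl_mulx1 (x : A) : mtl_mul L x \top = x.
Proof. by rewrite mtl_mulC mtl_mul1. Qed.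

Lemma mtl_le_mull (x y : A) : mtl_mul L x y <= x.
Proof.
rewrite mtl_mulC mtl_resP (le_trans (lex1 y)) // -mtl_resP.
by rewrite mtl_mul1.
Qed.

Lemma eval_fOr (P : language) (M : structure P A) (v : nat -> M)
    (phi psi : formula P) :
  eval L v (fOr phi psi) = eval L v phi `|` eval L v psi.
Proof.
rewrite /fOr /=; move: (eval L v phi) (eval L v psi).
have aux x y : x <= y ->
    mtl_res L (mtl_res L x y) y `&` mtl_res L (mtl_res L y x) x = y.
  move=> xy; have rT : mtl_res L x y = \top.
    by apply/eqP; rewrite -le1x -mtl_resP mtl_mul1.
  have rxy : mtl_res L (mtl_res L x y) y = y.
    apply/le_anti/andP; split.
      by have := lexx (mtl_res L (mtl_res L x y) y);
         rewrite -mtl_resP rT mtl_mulx1.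
    by rewrite -mtl_resP mtl_le_mull.
  rewrite rxy; apply/meet_idPl; rewrite -mtl_resP mtl_mulC mtl_resP.
  exact: lexx.
move=> x y; case/orP: (le_total x y) => h.
  by rewrite aux // (join_idPr h).
by rewrite meetC aux // (join_idPl h).
Qed.

Lemma pp_true_falsum_free (P : language) (M : structure P A) (v : nat -> M)
    (phi : formula P) :
  (\bot : A) <> \top -> pp_formula phi -> eval L v phi = \top ->
  falsum_free phi.
Proof.
move=> nt [xs [psi [hpsi ->]]].
have base : forall u : nat -> M, eval L u psi <> \bot -> falsum_free psi.
  move=> u; elim: psi hpsi => //= phi1 IH1 phi2 IH2 [h1 h2] h.
    split; [apply: IH1 => // e | apply: IH2 => // e]; apply: h.
      by apply/eqP; rewrite -lex0 e mtl_le_mull.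
    by apply/eqP; rewrite -lex0 e mtl_mulC mtl_le_mull.
  by split; [apply: IH1 => // e | apply: IH2 => // e]; apply: h;
     rewrite e ?meet0x ?meetx0.
move=> e; have {e} : eval L v (foldr (@fEx P) psi xs) <> \bot.
  by rewrite e => /esym.
elim: xs v => [|x xs IH] v /=; first exact: base.
move=> h; apply: contrapT => nf; apply: h.
apply/eqP; rewrite -lex0; apply/sup_famP => a.
by rewrite lex0; apply/eqP; apply: contrapT => /IH.
Qed.

End Checks.

(* Main.v *)
(** Let M be a model of the pp-consequences of T. For every pp-sentence phi
    failing in M choose a model of T in which phi fails, and let N be the
    product of these models: N is a model of T, and every pp-sentence true in N
    is true in M. Hence each finite part of the positive diagram of N is
    realized in M, which yields a homomorphism from N to an ultrapower of M
    indexed by the finite parts of that diagram. So the ultrapower is a model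
    of T, and so is M by Los's theorem, which holds because A is finite. *)
Require Import Defs.
From mathcomp Require Import all_boot all_order.
From mathcomp Require Import boolp classical_sets filter.

Set Implicit Arguments.
Unset Strict Implicit.
Unset Printing Implicit Defensive.

Import Order.TTheory.
Local Open Scope classical_set_scope.
Local Open Scope order_scope.

(** * Infima and suprema in a finite chain *)

Section BoundsAttained.
Context (d : Order.disp_t) (A : finTBOrderType d).

Lemma inf_fam_le (I : Type) (f : I -> A) i : inf_fam f <= f i.
Proof. exact: (inf_famP f _).1 (lexx _) i. Qed.

Lemma sup_fam_ge (I : Type) (f : I -> A) i : f i <= sup_fam f.
Proof. exact: (sup_famP f _).1 (lexx _) i. Qed.

(** The values form a nonempty part of a finite chain, which has a least element. *)
Lemma inf_fam_attained (I : Type) (f : I -> A) :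
  inhabited I -> exists i, inf_fam f = f i.
Proof.
move=> [i0].
have P0 : `[< exists i, f i = f i0 >] by apply/asboolP; exists i0.
case: (@arg_minP _ _ A (f i0) (fun a => `[< exists i, f i = a >]) id P0).
move=> a /asboolP [i <-] hmin; exists i; apply/le_anti/andP; split.
  exact: inf_fam_le.
by apply/inf_famP => j; apply: hmin; apply/asboolP; exists j.
Qed.

Lemma sup_fam_attained (I : Type) (f : I -> A) :
  inhabited I -> exists i, sup_fam f = f i.
Proof.
move=> [i0].
have P0 : `[< exists i, f i = f i0 >] by apply/asboolP; exists i0.
case: (@arg_maxP _ _ A (f i0) (fun a => `[< exists i, f i = a >]) id P0).
move=> a /asboolP [i <-] hmax; exists i; apply/le_anti/andP; split.
  by apply/sup_famP => j; apply: hmax; apply/asboolP; exists j.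
exact: sup_fam_ge.
Qed.

Lemma inf_fam_top (I : Type) (f : I -> A) :
  inf_fam f = \top <-> forall i, f i = \top.
Proof.
split=> [h i|h]; first by apply/eqP; rewrite -le1x -h inf_fam_le.
by apply/eqP; rewrite -le1x; apply/inf_famP => i; rewrite h.
Qed.

End BoundsAttained.

Lemma upd_id (D : Type) (v : nat -> D) x : upd v x (v x) = v.
Proof. by apply/funext => y; rewrite /upd; case: eqP => [->|]. Qed.

(** * Truth values and their dependence on assignments *)

Section Semantics.
Context (d : Order.disp_t) (A : finTBOrderType d) (L : MTL_algebra A).
Context (P : language).
Implicit Types (M N : structure P A) (phi psi : formula P).

(** By integrality a product lies below each factor. At the value [\top] strong conjunction thus
    acts classically, just as the lattice meet does. *)
Lemma mtl_mul_top (x y : A) :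
  mtl_mul L x y = \top <-> x = \top /\ y = \top.
Proof.
split=> [h|[-> ->]]; last by rewrite mtl_mul1.
by split; apply/eqP; rewrite -le1x -h ?mtl_le_mull // mtl_mulC mtl_le_mull.
Qed.

Lemma meet_top (x y : A) : x `&` y = \top <-> x = \top /\ y = \top.
Proof.
split=> [h|[-> ->]]; last by rewrite meetxx.
by split; apply/eqP; rewrite -le1x -h ?leIl ?leIr.
Qed.

Lemma teval_eq M (v w : nat -> M) (t : term P) :
  (forall x, occurs x t -> v x = w x) -> teval v t = teval w t.
Proof.
elim: t => [x|F ts IH] /= h; first exact: h.
by congr fun_interp; apply/funext => i; apply: IH => x hx; apply: h; exists i.
Qed.

Lemma eval_eq M (v w : nat -> M) phi :
  (forall x, free x phi -> v x = w x) -> eval L v phi = eval L w phi.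
Proof.
have updE x a (u1 u2 : nat -> M) psi :
    (forall y, y <> x /\ free y psi -> u1 y = u2 y) ->
    forall y, free y psi -> upd u1 x a y = upd u2 x a y.
  by move=> h y hy; rewrite /upd; case: eqP => // ne; apply: h.
elim: phi v w => [R ts|s t||p IHp q IHq|p IHp q IHq|p IHp q IHq|x p IH|x p IH]
    v w //= h.
- congr pred_interp; apply/funext => i; apply: teval_eq => x hx.
  by apply: h; exists i.
- by rewrite (@teval_eq _ v w s) ?(@teval_eq _ v w t) // => x hx;
     apply: h; [right|left].
- by rewrite (IHp v w) ?(IHq v w) // => x hx; apply: h; [right|left].
- by rewrite (IHp v w) ?(IHq v w) // => x hx; apply: h; [right|left].
- by rewrite (IHp v w) ?(IHq v w) // => x hx; apply: h; [right|left].
- by congr inf_fam; apply/funext => a; apply: IH; apply: updE.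
- by congr sup_fam; apply/funext => a; apply: IH; apply: updE.
Qed.

Lemma eval_sentence M (v w : nat -> M) phi :
  sentence phi -> eval L v phi = eval L w phi.
Proof. by move=> hs; apply: eval_eq => x /hs. Qed.

(** * Blocks of existential quantifiers *)

Lemma free_foldr_ex x psi (xs : seq nat) :
  free x (foldr (@fEx P) psi xs) -> free x psi /\ x \notin xs.
Proof.
elim: xs => //= y xs IH [/eqP ne /IH [h1 h2]]; split => //.
by rewrite inE negb_or ne.
Qed.

Lemma eval_foldr_ex_ge M (w : nat -> M) psi (xs : seq nat) :
  eval L w psi <= eval L w (foldr (@fEx P) psi xs).
Proof.
elim: xs => //= x xs IH; apply: (le_trans IH).
rewrite -{1}(upd_id w x).
exact: (sup_fam_ge (fun a => eval L (upd w x a) _)).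
Qed.

(** Each supremum is a maximum, so witnesses can be picked one quantifier at a time. *)
Lemma eval_foldr_ex M (v : nat -> M) psi (xs : seq nat) :
  exists w : nat -> M, eval L v (foldr (@fEx P) psi xs) = eval L w psi.
Proof.
elim: xs v => [|x xs IH] v /=; first by exists v.
have [a ->] := sup_fam_attained
  (fun a => eval L (upd v x a) (foldr (@fEx P) psi xs)) (inhabits (v x)).
exact: IH.
Qed.

(** The value of a sentence does not depend on the assignment, so [w] may differ from [v] outside
    [xs] too. *)
Lemma pp_sentence_top M (v : nat -> M) psi (xs : seq nat) :
  sentence (foldr (@fEx P) psi xs) ->
  eval L v (foldr (@fEx P) psi xs) = \top <->
  exists w : nat -> M, eval L w psi = \top.
Proof.
move=> hs; split=> [|[w hw]].
  by have [w ->] := eval_foldr_ex v psi xs; exists w.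
apply/eqP; rewrite -le1x (eval_sentence v w hs) -hw.
exact: eval_foldr_ex_ge.
Qed.

(** * Preservation under homomorphisms *)

Lemma homomorphism_teval M N (g : M -> N) (v : nat -> M) (t : term P) :
  homomorphism g -> teval (g \o v) t = g (teval v t).
Proof.
move=> [hF _]; elim: t => [x|F ts IH] //=.
by rewrite hF; congr fun_interp; apply/funext => i; apply: IH.
Qed.

Lemma homomorphism_matrix M N (g : M -> N) (v : nat -> M) psi :
  homomorphism g -> pp_matrix psi ->
  eval L v psi = \top -> eval L (g \o v) psi = \top.
Proof.
move=> hg; elim: psi => //= [R ts _|s t _|p IHp q IHq|p IHp q IHq].
- have -> : (fun i => teval (g \o v) (ts i)) = (fun i => g (teval v (ts i))).
    by apply/funext => i; apply: homomorphism_teval.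
  exact: hg.2.
(* If the terms differ in [M], the hypothesis reads [\bot = \top] and both possible values in [N]
   are [\top]. *)
- rewrite !homomorphism_teval //; case: asboolP => [-> _|_ ->].
    by case: asboolP.
  by case: ifP.
- by move=> [hp hq] /mtl_mul_top [ep eq]; apply/mtl_mul_top; split; auto.
- by move=> [hp hq] /meet_top [ep eq]; apply/meet_top; split; auto.
Qed.

Lemma homomorphism_pp M N (g : M -> N) phi (v : nat -> M) (w : nat -> N) :
  homomorphism g -> pp_sentence phi ->
  eval L v phi = \top -> eval L w phi = \top.
Proof.
move=> hg [[xs [psi [hpsi ->]]] hs] /(pp_sentence_top _ hs) [u hu].
by apply/(pp_sentence_top _ hs); exists (g \o u); apply: homomorphism_matrix.
Qed.

(** * Preservation under direct products *)

Lemma projection_homomorphism (I : Type) (Ms : I -> structure P A) (i : I) :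
  homomorphism (fun x : direct_product Ms => x i).
Proof. by split=> // R ds /= /inf_fam_top. Qed.

Lemma direct_product_teval (I : Type) (Ms : I -> structure P A)
    (v : nat -> direct_product Ms) (t : term P) i :
  teval v t i = teval (fun n => v n i) t.
Proof.
exact/esym/(homomorphism_teval v t (projection_homomorphism Ms i)).
Qed.

Lemma direct_product_matrix (I : Type) (Ms : I -> structure P A)
    (v : nat -> direct_product Ms) psi :
  inhabited I -> pp_matrix psi ->
  (forall i, eval L (fun n => v n i) psi = \top) -> eval L v psi = \top.
Proof.
move=> [i0]; elim: psi => //= [R ts _|s t _|_|p IHp q IHq|p IHp q IHq].
- move=> h; apply/inf_fam_top => i; rewrite -[RHS](h i).
  by congr pred_interp; apply/funext => k; apply: direct_product_teval.
- move=> h; case: asboolP => // ne.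
  have [i hi] : exists i, teval v s i <> teval v t i.
    by apply/existsNP => e; apply: ne; apply: functional_extensionality_dep.
  have := h i; rewrite -!direct_product_teval.
  by rewrite asboolF.
(* For [fBot] the hypothesis is taken at [i0]; over an empty index set it would be vacuous. *)
- exact.
- move=> [hp hq] h; apply/mtl_mul_top; split; [apply: IHp|apply: IHq] => // i;
    by have /mtl_mul_top [] := h i.
- move=> [hp hq] h; apply/meet_top; split; [apply: IHp|apply: IHq] => // i;
    by have /meet_top [] := h i.
Qed.

Lemma direct_product_pp (I : Type) (Ms : I -> structure P A) phi
    (v : nat -> direct_product Ms) :
  inhabited I -> pp_sentence phi ->
  (forall i (w : nat -> Ms i), eval L w phi = \top) -> eval L v phi = \top.
Proof.
move=> hI [[xs [psi [hpsi ->]]] hs] h; apply/(pp_sentence_top _ hs).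
have hw i : exists w : nat -> Ms i, eval L w psi = \top.
  exact: (pp_sentence_top (fun n => v n i) hs).1.
(* Witnesses chosen in each factor are assembled coordinatewise. *)
exists (fun n i => projT1 (cid (hw i)) n).
by apply: direct_product_matrix => // i; case: (cid (hw i)).
Qed.

End Semantics.

(** * Ultrapowers and Los's theorem *)

Section Ultrapower.
Context (d : Order.disp_t) (A : finTBOrderType d) (L : MTL_algebra A).
Context (P : language) (I : Type) (U : set_system I) (UU : UltraFilter U).
Context (M : structure P A).

(** Otherwise [f] avoids each value almost everywhere; as [A] is finite, it avoids all of them at
    once at some index. *)
Lemma ultra_limit_ex (f : I -> A) : exists a, \forall i \near U, f i = a.
Proof.
apply: contrapT => /forallNP h.
have /filter_forall /filter_ex [i] : forall a, \forall i \near U, f i <> a.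
  by move=> a; case: (in_ultra_setVsetC (fun i => f i = a) UU) => // /h.
by move/(_ (f i)).
Qed.

Definition ultra_limit (f : I -> A) : A := projT1 (cid (ultra_limit_ex f)).

Lemma ultra_limitP (f : I -> A) : \forall i \near U, f i = ultra_limit f.
Proof. by rewrite /ultra_limit; case: cid. Qed.

Lemma repr_ex (f : I -> M) : exists g : I -> M, \forall i \near U, f i = g i.
Proof. by exists f; apply: filterE. Qed.

Definition repr (f : I -> M) : I -> M := projT1 (cid (repr_ex f)).

Lemma reprP (f : I -> M) : \forall i \near U, f i = repr f i.
Proof. by rewrite /repr; case: cid. Qed.

(** The choice made by [cid] depends on a predicate and a proof that it is inhabited. Functions
    equal almost everywhere define the same predicate by extensionality, and proof irrelevance
    identifies the proofs. *)
Lemma repr_eq (f g : I -> M) :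
  (\forall i \near U, f i = g i) -> repr f = repr g.
Proof.
move=> fg; rewrite /repr.
move: (repr_ex f) (repr_ex g).
have -> : (fun h : I -> M => \forall i \near U, f i = h i) =
          (fun h : I -> M => \forall i \near U, g i = h i).
  apply/funext => h; apply/propext.
  by split; apply: filterS2 fg => i -> ->.
by move=> p q; rewrite (Prop_irrelevance p q).
Qed.

Lemma repr_idem (f : I -> M) : repr (repr f) = repr f.
Proof. by apply: repr_eq; apply: filterS (reprP f). Qed.

(* The quotient of [I -> M] by equality U-almost everywhere is represented by
   the canonical elements of its classes. *)
Definition ultrapower_dom : Type := {f : I -> M | repr f = f}.

Definition uclass (f : I -> M) : ultrapower_dom := exist _ _ (repr_idem f).

Lemma uclassP (f : I -> M) : \forall i \near U, sval (uclass f) i = f i.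
Proof. by apply: filterS (reprP f). Qed.

Lemma ultrapower_dom_eq (x y : ultrapower_dom) :
  (\forall i \near U, sval x i = sval y i) -> x = y.
Proof.
by case: x y => [f hf] [g hg] /= /repr_eq; rewrite hf hg => fg;
   apply: eq_exist.
Qed.

Lemma ultrapower_inhabited : inhabited ultrapower_dom.
Proof. by have [a] := dom_inhabited M; split; apply: uclass (fun=> a). Qed.

Definition ultrapower : structure P A :=
  {| dom := ultrapower_dom;
     dom_inhabited := ultrapower_inhabited;
     pred_interp := fun R ds =>
       ultra_limit (fun i => pred_interp (fun k => sval (ds k) i));
     fun_interp := fun F ds =>
       uclass (fun i => fun_interp (fun k => sval (ds k) i)) |}.

Definition coord (v : nat -> ultrapower) (i : I) : nat -> M :=
  fun n => sval (v n) i.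

Lemma ultrapower_teval (v : nat -> ultrapower) (t : term P) :
  \forall i \near U, teval (coord v i) t = sval (teval v t) i.
Proof.
elim: t => [x|F ts IH] /=; first exact: filterE.
apply: filterS2 (filter_forall _ IH)
  (uclassP (fun i => fun_interp (fun k => sval (teval v (ts k)) i))) => i h eu.
apply: (etrans _ (esym eu)); congr fun_interp; apply/funext => k; apply: h.
Qed.

Lemma coord_upd (v : nat -> ultrapower) x (a : ultrapower) i :
  coord (upd v x a) i = upd (coord v i) x (sval a i).
Proof. by apply/funext => y; rewrite /coord /upd; case: eqP. Qed.

(** Stated as an equality of truth values, so that connectives are computed in [A]. For a quantifier
    both bounds are attained: the optimal element [b] of the ultrapower gives one inequality, the
    class of the coordinatewise optima [f] gives the other. *)
Theorem los (v : nat -> ultrapower) (phi : formula P) :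
  \forall i \near U, eval L (coord v i) phi = eval L v phi.
Proof.
elim: phi v => [R ts|s t||p IHp q IHq|p IHp q IHq|p IHp q IHq|x p IH|x p IH]
    v /=.
- apply: filterS2 (filter_forall _ (fun k => ultrapower_teval v (ts k)))
    (ultra_limitP
      (fun i => pred_interp (fun k => sval (teval v (ts k)) i))) => i h eu.
  apply: (etrans _ eu); congr pred_interp; apply/funext => k; apply: h.
- case: asboolP => [e|ne].
    apply: filterS2 (ultrapower_teval v s) (ultrapower_teval v t) => i -> ->.
    by rewrite e asboolT.
  (* Along an ultrafilter the terms agree almost everywhere or differ almost everywhere; the former
     would identify their classes. *)
  have ne' : \forall i \near U, sval (teval v s) i <> sval (teval v t) i.
    case: (in_ultra_setVsetC
      (fun i => sval (teval v s) i = sval (teval v t) i) UU) => // e.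
    by case: ne; apply: ultrapower_dom_eq.
  apply: filterS3 ne' (ultrapower_teval v s) (ultrapower_teval v t).
  by move=> i ne' -> ->; rewrite asboolF.
- exact: filterE.
- by apply: filterS2 (IHp v) (IHq v) => i -> ->.
- by apply: filterS2 (IHp v) (IHq v) => i -> ->.
- by apply: filterS2 (IHp v) (IHq v) => i -> ->.
- have attained i : exists a : M,
      inf_fam (fun a => eval L (upd (coord v i) x a) p) =
      eval L (upd (coord v i) x a) p.
    exact: (inf_fam_attained (fun a => eval L (upd (coord v i) x a) p)
             (dom_inhabited M)).
  have [f hf] := choice attained.
  have [b hb] := inf_fam_attained (fun a => eval L (upd v x a) p)
    ultrapower_inhabited.
  apply: filterS3 (IH (upd v x b)) (IH (upd v x (uclass f))) (uclassP f) => i.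
  rewrite !coord_upd => eb ef eu; apply/le_anti/andP; split.
    by rewrite hb -eb; apply: (inf_fam_le (fun a => eval L (upd _ x a) p)).
  rewrite hf -eu ef.
  exact: (inf_fam_le (fun a : ultrapower => eval L (upd v x a) p)).
- have attained i : exists a : M,
      sup_fam (fun a => eval L (upd (coord v i) x a) p) =
      eval L (upd (coord v i) x a) p.
    exact: (sup_fam_attained (fun a => eval L (upd (coord v i) x a) p)
             (dom_inhabited M)).
  have [f hf] := choice attained.
  have [b hb] := sup_fam_attained (fun a => eval L (upd v x a) p)
    ultrapower_inhabited.
  apply: filterS3 (IH (upd v x b)) (IH (upd v x (uclass f))) (uclassP f) => i.
  rewrite !coord_upd => eb ef eu; apply/le_anti/andP; split.
    rewrite hf -eu ef.
    exact: (sup_fam_ge (fun a : ultrapower => eval L (upd v x a) p)).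
  by rewrite hb -eb; apply: (sup_fam_ge (fun a => eval L (upd _ x a) p)).
Qed.

Lemma ultrapower_model (T : formula P -> Prop) :
  theory T -> model L T ultrapower -> model L T M.
Proof.
move=> hT hU phi Tphi v; rewrite -(hU phi Tphi (fun n => uclass (fun=> v n))).
(* Representatives of constant sequences need not equal [v] at the index [i], but the value of a
   sentence is unaffected. *)
have [i <-] := filter_ex (los (fun n => uclass (fun=> v n)) phi).
exact/eval_sentence/hT.
Qed.

End Ultrapower.

(** * The positive diagram and homomorphisms into ultrapowers *)

Section PositiveDiagram.
Context (d : Order.disp_t) (A : finTBOrderType d) (L : MTL_algebra A).
Context (P : language) (N M : structure P A).

(** The single instances of the conditions on a homomorphism; each involves finitely many elements
    of [N]. *)
Inductive fact : Type :=
| FunFact (F : fun_sym P) of ('I_(fun_ar F) -> N)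
| PredFact (R : pred_sym P) of ('I_(pred_ar R) -> N).

Definition preserves (h : N -> M) (x : fact) : Prop :=
  match x with
  | FunFact F ds => h (fun_interp ds) = fun_interp (fun i => h (ds i))
  | PredFact R ds =>
      pred_interp ds = \top -> pred_interp (fun i => h (ds i)) = \top
  end.

(** [{classic N}] carries a classically decidable equality, which membership and [index] require. *)
Definition fact_elems (x : fact) : seq {classic N} :=
  match x with
  | FunFact F ds => fun_interp ds :: codom (ds : 'I__ -> {classic N})
  | PredFact R ds => codom (ds : 'I__ -> {classic N})
  end.

(** A predicate value below [\top] imposes no condition. Truth is written [fEq (Var 0) (Var 0)],
    because [fTop] is an implication and hence not a pp-matrix. *)
Definition fact_formula (name : N -> nat) (x : fact) : formula P :=
  match x with
  | FunFact F ds =>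
      fEq (Var (name (fun_interp ds))) (App F (fun i => Var (name (ds i))))
  | PredFact R ds =>
      if `[< pred_interp ds = \top >] then fPred R (fun i => Var (name (ds i)))
      else fEq (Var 0) (Var 0)
  end.

Definition diagram_formula (name : N -> nat) (s : seq {classic fact}) :=
  foldr (fun x => fWedge (fact_formula name x)) (fEq (Var 0) (Var 0)) s.

Lemma diagram_formula_matrix name s : pp_matrix (diagram_formula name s).
Proof.
elim: s => //= x s IH; split => //.
by case: x => //= R ds; case: asboolP.
Qed.

(** The alternative [x = 0] comes from the trivial equations on [Var 0]. *)
Lemma free_diagram_formula name s x :
  free x (diagram_formula name s) -> x = 0%N \/ exists n, x = name n.
Proof.
elim: s => [|y s IH] /=; first by case; left.
case=> //; case: y => [F ds|R ds] /=.
  by case=> [->|[i ->]]; right; eexists.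
by case: asboolP => _ /= [] => [i ->||]; [right; eexists|left|left].
Qed.

Lemma diagram_formula_top (M' : structure P A) (v : nat -> M') name s :
  eval L v (diagram_formula name s) = \top <->
  forall x, x \in s -> eval L v (fact_formula name x) = \top.
Proof.
elim: s => [|y s IH] /=; first by split=> // _; rewrite asboolT.
split=> [/meet_top [hy /IH hs] x|h].
  by rewrite inE => /orP [/eqP ->|/hs].
apply/meet_top; split; first by apply: h; rewrite inE eqxx.
by apply/IH => x xs; apply: h; rewrite inE xs orbT.
Qed.

Lemma fact_formula_top name (w : nat -> N) (x : fact) :
  (forall n : N, (n : {classic N}) \in fact_elems x -> w (name n) = n) ->
  eval L w (fact_formula name x) = \top.
Proof.
case: x => [F ds|R ds] /= h.
  rewrite asboolT // h ?inE ?eqxx //; congr fun_interp.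
  apply/funext => i; rewrite h // inE.
  by rewrite (codom_f (ds : _ -> {classic N})) orbT.
case: asboolP => [e|_] /=; last by rewrite asboolT.
rewrite -[RHS]e; congr pred_interp; apply/funext => i; apply: h.
exact: (codom_f (ds : _ -> {classic N})).
Qed.

(** Since [\bot] and [\top] differ, an equation of value [\top] is a true identity. *)
Lemma fact_formula_preserves name (w : nat -> M) (x : fact) :
  (\bot : A) <> \top -> eval L w (fact_formula name x) = \top ->
  preserves (fun n => w (name n)) x.
Proof.
move=> nt; case: x => [F ds|R ds] /=; first by case: asboolP.
by move=> h e; move: h; rewrite asboolT.
Qed.

Hypothesis nontrivial : (\bot : A) <> \top.
Hypothesis pp_transfer : forall phi (w : nat -> N) (v : nat -> M),
  pp_sentence phi -> eval L w phi = \top -> eval L v phi = \top.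

(** The existential closure of the conjunction of [s] is a pp-sentence true in [N], hence in [M].
    Witnesses [w] in [M] define the map sending [n] to the value of its variable. *)
Lemma finite_diagram_realized (s : seq {classic fact}) :
  exists h : N -> M, forall x, x \in s -> preserves h x.
Proof.
have [n0] := dom_inhabited N; have [m0] := dom_inhabited M.
pose e := flatten [seq fact_elems x | x <- s].
pose name (n : N) := index (n : {classic N}) e.
pose psi := diagram_formula name s.
(* [index] names every element outside [e] by [size e], whence the extra
   variable. *)
pose xs := iota 0 (size e).+1.
have closed : sentence (foldr (@fEx P) psi xs).
  move=> x /free_foldr_ex [/free_diagram_formula hx].
  rewrite mem_iota /= add0n ltnS => /negP; apply.
  by case: hx => [->|[n ->]] //; apply: index_size.
have hN : exists w : nat -> N, eval L w psi = \top.
  (* On elements of [e], [nth] undoes [index], so each such element is the value of its own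
     variable. *)
  exists (nth (n0 : {classic N}) e); apply/diagram_formula_top => x xs'.
  apply: fact_formula_top => n hn; rewrite /name nth_index //.
  exact: (introT flatten_mapP (ex_intro2 _ _ x xs' hn)).
have /(pp_sentence_top L (fun=> m0) closed) [w hw] :
    eval L (fun=> m0) (foldr (@fEx P) psi xs) = \top.
  apply: (@pp_transfer _ (fun=> n0)); last exact/(pp_sentence_top L _ closed).
  by split=> //; exists xs, psi; split=> //; apply: diagram_formula_matrix.
exists (fun n => w (name n)) => x xs'; apply: fact_formula_preserves => //.
exact: (diagram_formula_top w name s).1 hw x xs'.
Qed.

(** Send [n] to the class of [s |-> h s n], where [h s] preserves the facts in [s]. Every fact is
    then preserved at almost all [s], hence in the ultrapower. *)
Lemma homomorphism_to_ultrapower :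
  exists (I : Type) (U : set_system I) (UU : UltraFilter U)
    (g : N -> ultrapower UU M), homomorphism g.
Proof.
pose I := seq {classic fact}.
(* This filter is generated by the cones of lists containing a given [s0]. It is proper because [s0]
   lies in its own cone. *)
pose cofinal : set_system I := fun Q =>
  exists s0 : I, forall s : I, {subset s0 <= s} -> Q s.
have cofinal_proper : ProperFilter cofinal.
  split; first by case=> s0 /(_ s0); apply.
  split; first by exists [::].
    move=> Q1 Q2 [s1 h1] [s2 h2]; exists (s1 ++ s2) => s hs.
    by split; [apply: h1|apply: h2] => x hx; apply: hs;
       rewrite mem_cat hx ?orbT.
  by move=> Q1 Q2 Q12 [s0 h]; exists s0 => s /h /Q12.
have [U [UU cofU]] := ultraFilterLemma cofinal_proper.
have UF : Filter U by exact: filter_filter.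
have [h hP] := choice finite_diagram_realized.
have hU (x : {classic fact}) : \forall s \near U, preserves (h s) x.
  by apply: cofU; exists [:: x] => s hs; apply: hP; apply: hs; rewrite inE.
exists I, U, UU, (fun n => uclass UU (fun s => h s n)); split.
  move=> F ds; apply: ultrapower_dom_eq.
  have hds := filter_forall UF (fun k => uclassP UU (fun s => h s (ds k))).
  have hF := uclassP UU (fun s =>
    fun_interp (fun k => sval (uclass UU (fun s' => h s' (ds k))) s)).
  have hn := uclassP UU (fun s => h s (fun_interp ds)).
  apply: filterS2 (filterI (hU (FunFact ds)) hds) (filterI hF hn) => s.
  move=> [/= e {}hds] [eF en]; rewrite en e; apply: (etrans _ (esym eF)).
  by congr fun_interp; apply/funext => k; rewrite -hds.
move=> R ds e.
have hds := filter_forall UF (fun k => uclassP UU (fun s => h s (ds k))).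
have hlim := ultra_limitP UU
  (fun s => pred_interp (fun k => sval (uclass UU (fun s' => h s' (ds k))) s)).
(* Conditions holding almost everywhere share an index [s]; there the predicate has value [\top] and
   equals its limit. *)
have [s [[hs hds'] es]] :=
  filter_ex (filterI (filterI (hU (PredFact ds)) hds) hlim).
apply: (etrans (esym es)); rewrite -[RHS](hs e); congr pred_interp.
by apply/funext => k; apply: hds'.
Qed.

End PositiveDiagram.

(** * Closure properties and pp-axiomatizability *)

Theorem theorem4p5 (d : Order.disp_t) (A : finTBOrderType d)
    (L : MTL_algebra A) (P : language) (T : formula P -> Prop)
    (hT : theory T) (hcons : consistent T) :
  closed_under_homomorphisms L T /\ closed_under_products L T <->
  exists Sigma : formula P -> Prop,
    (forall phi, Sigma phi -> pp_sentence phi) /\ axiomatized_by L T Sigma.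
Proof.
split=> [[hom_closed prod_closed]|[Sigma [hpp hax]]]; last first.
  split=> [M N g hg /hax hM|I Ms hI hMs]; apply/hax => phi Sphi v.
    have [a] := dom_inhabited M.
    exact: (homomorphism_pp (v := fun=> a) v hg (hpp _ Sphi) (hM _ Sphi _)).
  apply: direct_product_pp => // [|i w]; first exact: hpp.
  exact: ((hax (Ms i)).1 (hMs i)).
exists (fun phi => pp_sentence phi /\
  forall N : structure P A, model L T N -> forall v : nat -> N,
    eval L v phi = \top).
split=> [phi []//|M]; split=> [hM phi [_ h] v|hM]; first exact: h.
(* In the one-element algebra every formula has value [\top]. Otherwise equations express identity,
   as the diagram argument requires. *)
have [trivial|nontrivial] := pselect ((\bot : A) = \top).
  by move=> phi _ v; apply/eqP; rewrite -le1x -trivial le0x.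
pose J := {phi : formula P |
  pp_sentence phi /\ exists v : nat -> M, eval L v phi <> \top}.
have countermodel (j : J) : exists N : structure P A,
    model L T N /\ exists v : nat -> N, eval L v (sval j) <> \top.
  case: j => phi [ppphi [v hv]] /=; apply: contrapT => none; apply: hv.
  (* Without a countermodel [phi] would be a pp-consequence of [T], hence true in [M]. *)
  apply: hM; split=> // N hN u; apply: contrapT => hu.
  by apply: none; exists N; split=> //; exists u.
(* [fBot] is a pp-sentence failing in M, so T has a model: the product below is
   taken over a nonempty family. *)
have hJ : inhabited J.
  have [a] := dom_inhabited M; split; exists fBot; split.
    by split; [exists [::], fBot | move=> x []].
  by exists (fun=> a).
pose Ns (j : J) := projT1 (cid (countermodel j)).
have hNs j : model L T (Ns j) /\
    exists v : nat -> Ns j, eval L v (sval j) <> \top.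
  exact: projT2 (cid (countermodel j)).
have transfer phi (w : nat -> direct_product Ns) (v : nat -> M) :
    pp_sentence phi -> eval L w phi = \top -> eval L v phi = \top.
  move=> ppphi hw; apply: contrapT => hv.
  (* A pp-sentence failing in [M] indexes a factor in which it fails, whereas the projection to that
     factor would preserve its truth in the product. *)
  pose j : J := exist _ phi (conj ppphi (ex_intro _ v hv)).
  have [_ [u]] := hNs j; apply.
  exact: (homomorphism_pp u (projection_homomorphism Ns j) ppphi hw).
have [I [U [UU [g hg]]]] := homomorphism_to_ultrapower nontrivial transfer.
apply: (ultrapower_model (UU := UU) hT); apply: (hom_closed _ _ g hg).
by apply: prod_closed => // j; case: (hNs j).
Qed.
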